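(* Let $m$, $n$ and $q$ be positive integers such that $q$ is even or $mnq$ is odd. Then \[ \sum_{k = 1}^\infty \frac{(-1)^{k-1}F_{2nk+mnq}}{\prod_{j=0}^{m} F_{nk+jnq}^2} = \frac{1}{F_{mnq}}\sum_{k=1}^{q}\frac{(-1)^{k-1}}{\prod_{j=0}^{m-1}F_{nk+jnq}^2}. \]
   Context: The Fibonacci numbers are defined by $F_0=0$, $F_1=1$, $F_n=F_{n-1}+F_{n-2}$. Infinite sums are limits of partial sums. *)

(* Defs.v *)
From mathcomp Require Import all_boot.

Set Implicit Arguments.
Unset Strict Implicit.
Unset Printing Implicit Defensive.

(* Stdlib's Zgcd_alt.fibonacci is the shifted sequence 1, 1, 2, ... *)
Fixpoint fib (n : nat) : nat :=
  match n with
  | 0 => 0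
  | p.+1 => match p with
            | 0 => 1
            | r.+1 => fib p + fib r
            end
  end.

(* Main.v *)
Require Import Defs.
From mathcomp Require Import all_boot all_order all_algebra.
From mathcomp Require Import all_classical all_reals all_analysis.
From mathcomp Require Import ring zify.

Import Order.TTheory GRing.Theory Num.Theory.
Import numFieldNormedType.Exports.

Local Open Scope classical_set_scope.
Local Open Scope ring_scope.

(** With M = mnq, the identity F_(a+M)^2 - (-1)^M F_a^2 = F_M F_(2a+M) at a = nk
    turns the k-th term into (g k - (-1)^(M+q) g (k+q)) / F_M, where
    g k = (-1)^(k-1) / prod_(j < m) F_(nk+jnq)^2.  The parity hypothesis says
    exactly that M + q is even, so the series telescopes with step q, and
    g tends to 0. *)

Lemma fibSS n : fib n.+2 = (fib n.+1 + fib n)%N.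
Proof. by []. Qed.

Lemma fibD a b : fib (a + b).+1 = (fib a.+1 * fib b.+1 + fib a * fib b)%N.
Proof.
elim: a b => [|a IHa] b; first by rewrite !add0n mul1n mul0n addn0.
by rewrite addSnnS IHa !fibSS; ring.
Qed.

(** Cassini's identity without the index [n - 1]: the form x^2 - xy - y^2 changes sign under (x, y)
    -> (x + y, x). *)
Lemma fib_cassini (R : comPzRingType) n :
  (fib n.+1)%:R ^+ 2 - (fib n.+1)%:R * (fib n)%:R - (fib n)%:R ^+ 2
    = (-1) ^+ n :> R.
Proof.
elim: n => [|n IHn]; first by rewrite /=; ring.
by rewrite [RHS]exprS -IHn fibSS natrD; ring.
Qed.

(** The addition formula reduces everything to F_a, F_(a+1), F_b and F_(b+1). Once Cassini replaces
    (-1)^b by a quadratic form, a polynomial identity in these four values remains. *)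
Lemma fib_sqr_sub (R : comPzRingType) a b :
  (fib (a + b))%:R ^+ 2 - (-1) ^+ b * (fib a)%:R ^+ 2
    = (fib b)%:R * (fib (2 * a + b))%:R :> R.
Proof.
(* Here F_(c-1) is written F_(c+1) - F_c, so that c = 0 is covered. *)
have fibDR c d : (fib (c + d))%:R =
    (fib c)%:R * (fib d.+1)%:R + ((fib c.+1)%:R - (fib c)%:R) * (fib d)%:R :> R.
  case: c => [|c]; first by rewrite add0n /=; ring.
  by rewrite addSn fibD fibSS !natrD !natrM; ring.
rewrite mul2n -addnn -addnA (fibDR a (a + b)%N) fibD natrD !natrM (fibDR a b).
by rewrite -fib_cassini; ring.
Qed.

Lemma fib_gt0 n : (0 < n)%N -> (0 < fib n)%N.
Proof.
case: n => // n _; elim: n => [//|n IHn].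
by rewrite fibSS ltn_addr.
Qed.

(** A crude linear growth bound, enough for comparison with the harmonic sequence. *)
Lemma leq_double_fib n : (n <= 2 * fib n)%N.
Proof.
suff: (n <= 2 * fib n)%N && (n.+1 <= 2 * fib n.+1)%N by case/andP.
elim: n => [//|[//|n] /andP[IHn IHSn]].
by rewrite IHSn (fibSS n.+1); lia.
Qed.

Lemma sum_sub_shift (V : zmodType) (f : nat -> V) q N :
  \sum_(0 <= k < N) (f k - f (k + q)%N)
    = \sum_(0 <= k < q) f k - \sum_(0 <= k < q) f (k + N)%N.
Proof.
elim: N => [|N IHN].
  rewrite big_geq //; under [X in _ - X]eq_bigr do rewrite addn0.
  by rewrite subrr.
rewrite big_nat_recr //= IHN -addrA; congr (_ + _).
(* Sliding the window of length q from N to N + 1 drops f N and gains f (N + q). *)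
under [in RHS]eq_bigr do rewrite -addSnnS.
have := telescope_sumr (fun k => f (k + N)%N) (leq0n q).
rewrite sumrB add0n (addnC q) => /eqP; rewrite subr_eq => /eqP ->.
by rewrite opprD opprB addrC.
Qed.

(** The subtracted window always has q terms, each tending to 0. *)
Lemma cvg_sum_sub_shift (R : realType) (f : nat -> R) q :
  f @ \oo --> (0 : R) ->
  (\sum_(0 <= k < N) (f k - f (k + q)%N)) @[N --> \oo]
    --> \sum_(0 <= k < q) f k.
Proof.
move=> f0; under eq_fun do rewrite sum_sub_shift.
suff tail0 : (\sum_(0 <= k < q) f (k + N)%N) @[N --> \oo] --> (0 : R).
  by rewrite -[X in nbhs X]subr0; apply: cvgB tail0; exact: cvg_cst.
elim: q => [|q IHq]; first by under eq_fun do rewrite big_geq //; exact: cvg_cst.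
under eq_fun do rewrite big_nat_recr //=.
rewrite -[X in nbhs X]addr0; apply: cvgD => //.
by move: f0; rewrite -(cvg_shiftn q); under eq_fun do rewrite addnC; exact.
Qed.

Lemma cvg_inv_prod_fib (R : realType) (m n q : nat) :
    (0 < m)%N -> (0 < n)%N ->
  ((-1) ^+ k / \prod_(0 <= j < m) (fib (n * k.+1 + j * n * q))%:R ^+ 2 : R)
    @[k --> \oo] --> (0 : R).
Proof.
move=> m_gt0 n_gt0; apply/norm_cvg0P.
have harm0 : (2 * @harmonic R k) @[k --> \oo] --> (0 : R).
  by rewrite -(mulr0 (2 : R)); apply: cvgM (cvg_cst _) cvg_harmonic.
apply: (squeeze_cvgr _ (cvg_cst 0) harm0).
apply: nearW => k; rewrite normr_ge0 /= normrM normrX normrN1 expr1n mul1r.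
rewrite normfV -ler_pdivrMl // -invfM.
under eq_bigr do rewrite -natrX.
rewrite -natr_prod normr_nat -natrM lef_pV2 ?posrE ?ltr0n //; last first.
  rewrite muln_gt0 /= prodn_gt0 // => j.
  by rewrite expn_gt0 fib_gt0 // ltn_addr // muln_gt0 n_gt0.
(* The factor j = 0 alone gives the bound, as k + 1 <= n(k+1) <= 2 F_(n(k+1)); all other factors are
   positive integers, hence at least 1. *)
rewrite ler_nat; case: m m_gt0 => // m _; rewrite big_nat_recl //=.
have k_le : (k.+1 <= n * k.+1)%N by rewrite leq_pmull.
have fn_gt0 : (0 < fib (n * k.+1))%N by rewrite fib_gt0 // muln_gt0 n_gt0.
rewrite !mul0n addn0 (leq_trans k_le) // (leq_trans (leq_double_fib _)) //.
rewrite leq_mul2l /= -mulnA leq_pmulr // muln_gt0 fn_gt0 prodn_gt0 // => j.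
by rewrite expn_gt0 fib_gt0 // ltn_addr // muln_gt0 n_gt0.
Qed.

Theorem theorem2p38 (R : realType) (m n q : nat)
    (m_gt0 : (0 < m)%N) (n_gt0 : (0 < n)%N) (q_gt0 : (0 < q)%N)
    (parity : ~~ odd q \/ odd (m * n * q)) :
  (\sum_(1 <= k < N.+1)
      ((-1) ^+ (k - 1) * (fib (2 * n * k + m * n * q))%:R
       / \prod_(0 <= j < m.+1) (fib (n * k + j * n * q))%:R ^+ 2 : R))
    @[N --> \oo] -->
  ((fib (m * n * q))%:R^-1
   * \sum_(1 <= k < q.+1)
      ((-1) ^+ (k - 1)
       / \prod_(0 <= j < m) (fib (n * k + j * n * q))%:R ^+ 2) : R).
Proof.
(* Indices are counted from 0: [P k] and [g k] belong to the summation index k + 1, so the sign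
   (-1)^(k-1) becomes (-1)^k. *)
pose P k : R := \prod_(0 <= j < m) (fib (n * k.+1 + j * n * q))%:R ^+ 2.
pose g k : R := (-1) ^+ k / P k.
have fib_neq0 k j : (fib (n * k.+1 + j))%:R != 0 :> R.
  by rewrite pnatr_eq0 -lt0n fib_gt0 // ltn_addr // muln_gt0 n_gt0.
have P_neq0 k : P k != 0.
  by rewrite prodf_seq_neq0; apply/allP => j _; rewrite /= expf_neq0.
have fM_neq0 : (fib (m * n * q))%:R != 0 :> R.
  by rewrite pnatr_eq0 -lt0n fib_gt0 // !muln_gt0 m_gt0 n_gt0.
(* An even q makes mnq even, and an odd mnq forces q to be odd. *)
have signE : (-1) ^+ (m * n * q) = (-1) ^+ q :> R.
  rewrite -signr_odd -[RHS]signr_odd; congr (_ ^+ nat_of_bool _).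
  by move: parity; rewrite !oddM; case: (odd q); rewrite ?andbF ?andbT //; case.
have termE k : (-1) ^+ k * (fib (2 * n * k.+1 + m * n * q))%:R
    / \prod_(0 <= j < m.+1) (fib (n * k.+1 + j * n * q))%:R ^+ 2
    = (fib (m * n * q))%:R^-1 * (g k - g (k + q)%N) :> R.
  set A : R := (fib (n * k.+1))%:R ^+ 2.
  set B : R := (fib (n * k.+1 + m * n * q))%:R ^+ 2.
  have A_neq0 : A != 0 by rewrite expf_neq0 // -(addn0 (n * _)%N).
  have B_neq0 : B != 0 by rewrite expf_neq0.
  have prodB : \prod_(0 <= j < m.+1) (fib (n * k.+1 + j * n * q))%:R ^+ 2
      = P k * B by rewrite big_nat_recr.
  (* The product of m + 1 factors is split at its first factor instead of its last; since (j+1)nq =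
     nq + jnq, the remaining factors are those of [P (k + q)]. *)
  have prodA : P k * B = A * P (k + q)%N.
    rewrite -prodB big_nat_recl // !mul0n addn0; congr (_ * _).
    by apply: eq_bigr => j _; congr ((fib _)%:R ^+ 2); ring.
  have key : B - (-1) ^+ q * A
      = (fib (m * n * q))%:R * (fib (2 * n * k.+1 + m * n * q))%:R.
    by rewrite -signE fib_sqr_sub mulnA.
  (* Over the common denominator [P k * B], the difference of the two [g] values has numerator
     (-1)^k (B - (-1)^q A), which [key] evaluates. *)
  have -> : g (k + q)%N = (-1) ^+ k * (-1) ^+ q * A / (P k * B).
    rewrite /g exprD prodA; field.
    by rewrite P_neq0 A_neq0.
  rewrite prodB -[X in _ * X / _](mulKf fM_neq0) -key /g; field.
  by rewrite P_neq0 B_neq0 fM_neq0.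
have partialE N : \sum_(1 <= k < N.+1)
      ((-1) ^+ (k - 1) * (fib (2 * n * k + m * n * q))%:R
       / \prod_(0 <= j < m.+1) (fib (n * k + j * n * q))%:R ^+ 2)
    = (fib (m * n * q))%:R^-1 * \sum_(0 <= k < N) (g k - g (k + q)%N) :> R.
  by rewrite big_add1 mulr_sumr; apply: eq_bigr => k _; rewrite subn1 termE.
rewrite (eq_cvg _ _ partialE).
rewrite big_add1 /=; under eq_bigr do rewrite subn1.
apply: cvgM; first exact: cvg_cst.
apply: cvg_sum_sub_shift; exact: cvg_inv_prod_fib.
Qed.
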